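(* Let $D$ be a domain. Let $X=(R_1,\dots,R_p)$ range over tuples of relations with $R_i\subseteq D^{a_i}\times D^{b_i}$, and let $X'=(R'_1,\dots,R'_p)$ range over tuples of relations with $R'_i\subseteq D^{a_i}$. Let $F$ be a monotone function mapping tuples of the type of $X$ to tuples of the type of $X$, and let $F'$ be a monotone function mapping pairs $(X',X)$ to tuples of the type of $X'$. Consider the two programs $$\Pi:\quad X \text{ :- } F(X)\qquad\qquad \Pi_O:\quad \begin{cases} X'_O \text{ :- } F'(X'_O,X_O)\\ X_O \text{ :- } X'_O\wedge F(X_O).\end{cases}$$ Let $\bar X$ be the least fixpoint of $\Pi$, and let $(\bar X'_O,\bar X_O)$ be the least fixpoint of $\Pi_O$. Suppose $\Pi_O$ satisfies Property B, i.e. for every $X$ that is bounded with respect to $\Pi_O$ (meaning $\bar X'_O\wedge X\Rightarrow \bar X_O$) one has $$\bar X'_O\wedge F(X)=\bar X'_O\wedge F(\bar X'_O\wedge X).$$ Then $$\bar X'_O\wedge\bar X=\bar X_O.$$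
   Context: Relations are Boolean-valued (sets of tuples over $D$). For tuples of relations $X,Y$ of the same type (same number of relations, same arities), $X\Rightarrow Y$ means component-wise set inclusion; monotone means monotone for this order (on pairs, the product order). For $X'=(R'_1,\dots,R'_p)$ and $X=(R_1,\dots,R_p)$ as in the claim, $X'\wedge X$ is the tuple of the same type as $X$ whose $i$-th component is $\{(u,v)\in D^{a_i}\times D^{b_i} : u\in R'_i \text{ and } (u,v)\in R_i\}$. The semantics of a program $X\text{ :- }F(X)$ is the least fixpoint of $F$; the semantics of $\Pi_O$ is the least fixpoint of the map $(X'_O,X_O)\mapsto (F'(X'_O,X_O),\,X'_O\wedge F(X_O))$. *)

(* Defs.v *)
From mathcomp Require Import all_boot.
From mathcomp Require Import classical_sets.

Set Implicit Arguments.
Unset Strict Implicit.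
Unset Printing Implicit Defensive.

Local Open Scope classical_set_scope.

Definition rels (p : nat) (T : 'I_p -> Type) : Type := forall i, set (T i).

Definition rels_imp (p : nat) (T : 'I_p -> Type) (X Y : rels T) : Prop :=
  forall i, X i `<=` Y i.

Definition rels_imp2 (p q : nat) (T : 'I_p -> Type) (U : 'I_q -> Type)
    (x y : rels T * rels U) : Prop :=
  rels_imp x.1 y.1 /\ rels_imp x.2 y.2.

(* Least element, for the order [le], of the set of fixpoints of [f].  Its
   existence for monotone [f] is the Knaster-Tarski theorem. *)
Definition is_lfp (A : Type) (le : A -> A -> Prop) (f : A -> A) (x : A) : Prop :=
  f x = x /\ forall y, f y = y -> le x y.

(* [rels1 D a] is the type of X' = (R'_1, ..., R'_p) with R'_i a subset of
   D^(a i), and [rels2 D a b] that of X = (R_1, ..., R_p) with R_i a subset of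
   D^(a i) * D^(b i). *)
Definition rels1 (D : Type) (p : nat) (a : 'I_p -> nat) : Type :=
  rels (fun i => (a i).-tuple D).

Definition rels2 (D : Type) (p : nat) (a b : 'I_p -> nat) : Type :=
  rels (fun i => ((a i).-tuple D * (b i).-tuple D)%type).

Section Programs.
Variables (D : Type) (p : nat) (a b : 'I_p -> nat).

Definition rmeet (X' : rels1 D a) (X : rels2 D a b) : rels2 D a b :=
  fun i => [set uv | X' i uv.1 /\ X i uv].

Definition progO (F : rels2 D a b -> rels2 D a b)
    (F' : rels1 D a * rels2 D a b -> rels1 D a)
    (x : rels1 D a * rels2 D a b) : rels1 D a * rels2 D a b :=
  (F' x, rmeet x.1 (F x.2)).

(* In the next two definitions, [(X'O, XO)] is meant to be the least fixpoint
   of [progO F F']. *)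
Definition boundedO (X'O : rels1 D a) (XO X : rels2 D a b) : Prop :=
  rels_imp (rmeet X'O X) XO.

Definition propertyB (F : rels2 D a b -> rels2 D a b)
    (X'O : rels1 D a) (XO : rels2 D a b) : Prop :=
  forall X : rels2 D a b, boundedO X'O XO X ->
    rmeet X'O (F X) = rmeet X'O (F (rmeet X'O X)).

End Programs.

(* Main.v *)
Require Import Defs.
From mathcomp Require Import all_boot.
From mathcomp Require Import boolp classical_sets.

Set Implicit Arguments.
Unset Strict Implicit.
Unset Printing Implicit Defensive.

(** Both inclusions use that the least fixpoint of a monotone map lies below
    each of its prefixpoints.  For [X'O /\ X => XO], the largest bounded tuple
    [Y], given by [Y(u, v) <-> (X'O(u) -> XO(u, v))], satisfies
    [X'O /\ Y = XO], so Property B yields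
    [X'O /\ F Y = X'O /\ F XO = XO], i.e. [F Y => Y], whence [X => Y].
    This inclusion and the monotonicity of [F'] make [(X'O, X'O /\ X)] a
    prefixpoint of [Pi_O], which gives the converse. *)

(** Knaster-Tarski: since [is_lfp] compares [x] only with fixpoints, [y] is reached through the
    greatest lower bound [g] of all prefixpoints. Monotonicity makes [g] a prefixpoint, hence also
    [f g], so [g] is a fixpoint and [x] lies below [g], which lies below [y]. The order is abstract
    to serve both tuples and pairs of tuples. *)
Lemma lfp_le_prefixpoint (A : Type) (le : A -> A -> Prop) (f : A -> A)
    (le_trans : forall y x z, le x y -> le y z -> le x z)
    (le_anti : forall x y, le x y -> le y x -> x = y)
    (has_glb : forall P : A -> Prop, exists g,
      (forall y, P y -> le g y) /\ (forall z, (forall y, P y -> le z y) -> le z g))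
    (f_mono : {homo f : x y / le x y >-> le x y}) (x y : A) :
  is_lfp le f x -> le (f y) y -> le x y.
Proof.
case=> _ x_min fy_le.
have [g [g_lb g_glb]] := has_glb (fun z => le (f z) z).
have fg_le : le (f g) g.
  by apply: g_glb => z fz_le; apply: (le_trans (f z)) => //; apply/f_mono/g_lb.
have g_le : le g (f g) by apply/g_lb/f_mono.
exact: le_trans (x_min g (le_anti _ _ fg_le g_le)) (g_lb y fy_le).
Qed.

Section RelsOrder.
Context {p q : nat} {T : 'I_p -> Type} {U : 'I_q -> Type}.

Lemma rels_imp_trans (Y X Z : rels T) :
  rels_imp X Y -> rels_imp Y Z -> rels_imp X Z.
Proof. by move=> XY YZ i t /XY /YZ. Qed.

Lemma rels_imp_anti (X Y : rels T) : rels_imp X Y -> rels_imp Y X -> X = Y.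
Proof. by move=> XY YX; apply: functional_extensionality_dep => i; apply/seteqP. Qed.

Lemma rels_imp_has_glb (P : rels T -> Prop) : exists G : rels T,
  (forall Y, P Y -> rels_imp G Y) /\
  (forall Z, (forall Y, P Y -> rels_imp Z Y) -> rels_imp Z G).
Proof.
exists (fun i t => forall Y, P Y -> Y i t).
by split=> [Y PY i t | Z Z_lb i t Zt Y /Z_lb]; apply.
Qed.

Lemma rels_imp2_trans (y x z : rels T * rels U) :
  rels_imp2 x y -> rels_imp2 y z -> rels_imp2 x z.
Proof. by move=> [x1 x2] [y1 y2]; split=> i t; [move/x1/y1 | move/x2/y2]. Qed.

Lemma rels_imp2_anti (x y : rels T * rels U) :
  rels_imp2 x y -> rels_imp2 y x -> x = y.
Proof.
case: x y => [x1 x2] [y1 y2] [/= xy1 xy2] [/= yx1 yx2].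
congr pair; apply: functional_extensionality_dep => i; apply/seteqP; split;
  [exact: xy1 | exact: yx1 | exact: xy2 | exact: yx2].
Qed.

Lemma rels_imp2_has_glb (P : rels T * rels U -> Prop) : exists g,
  (forall y, P y -> rels_imp2 g y) /\
  (forall z, (forall y, P y -> rels_imp2 z y) -> rels_imp2 z g).
Proof.
exists (fun i t => forall y, P y -> y.1 i t, fun i t => forall y, P y -> y.2 i t).
split=> [y Py | z z_lb]; first by split=> i t /(_ y Py).
by split=> i t zt y /z_lb[z1 z2]; [apply: z1 | apply: z2].
Qed.

End RelsOrder.

Lemma rmeet_mono (D : Type) (p : nat) (a b : 'I_p -> nat)
    (X' Y' : rels1 D a) (X Y : rels2 D a b) :
  rels_imp X' Y' -> rels_imp X Y -> rels_imp (rmeet X' X) (rmeet Y' Y).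
Proof. by move=> XY' XY i uv [/XY' ? /XY]. Qed.

Lemma progO_mono (D : Type) (p : nat) (a b : 'I_p -> nat)
    (F : rels2 D a b -> rels2 D a b)
    (F' : rels1 D a * rels2 D a b -> rels1 D a) :
  {homo F : X Y / rels_imp X Y >-> rels_imp X Y} ->
  {homo F' : x y / rels_imp2 x y >-> rels_imp x y} ->
  {homo progO F F' : x y / rels_imp2 x y >-> rels_imp2 x y}.
Proof.
move=> F_mono F'_mono x y xy; split; first exact: F'_mono.
by case: xy => xy1 /F_mono; apply: rmeet_mono.
Qed.

Theorem theoremC10 (D : Type) (p : nat) (a b : 'I_p -> nat)
    (F : rels2 D a b -> rels2 D a b)
    (F' : rels1 D a * rels2 D a b -> rels1 D a)
    (F_mono : {homo F : X Y / rels_imp X Y >-> rels_imp X Y})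
    (F'_mono : {homo F' : x y / rels_imp2 x y >-> rels_imp x y})
    (X : rels2 D a b) (X'O : rels1 D a) (XO : rels2 D a b)
    (X_lfp : is_lfp (@rels_imp _ _) F X)
    (XO_lfp : is_lfp (@rels_imp2 _ _ _ _) (progO F F') (X'O, XO))
    (hB : propertyB F X'O XO) :
  rmeet X'O X = XO.
Proof.
have [[F'XO FXO] _] := XO_lfp.
(* The second fixpoint equation exhibits [XO] as a meet with [X'O]. *)
have XO_X'O i uv : XO i uv -> X'O i uv.1.
  by move=> XOuv; move: XOuv; rewrite -{1}FXO => -[].
have X_XO : rels_imp (rmeet X'O X) XO.
  pose Y : rels2 D a b := fun i uv => X'O i uv.1 -> XO i uv.
  have Y_bounded : boundedO X'O XO Y by move=> i uv [X'u]; apply.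
  have Y_XO : rmeet X'O Y = XO.
    by apply: rels_imp_anti => // i uv XOuv; split; first exact: XO_X'O XOuv.
  have FY : rels_imp (F Y) Y.
    move=> i uv FYuv X'u.
    (* The premise [X'u] supplies the guard [X'O], the form in which Property B can rewrite
       [F Y]. *)
    suff: (rmeet X'O (F Y)) i uv by rewrite hB // Y_XO FXO.
    by split.
  have XY := lfp_le_prefixpoint rels_imp_trans rels_imp_anti rels_imp_has_glb
    F_mono X_lfp FY.
  by move=> i uv [X'u /XY]; apply.
apply: rels_imp_anti => //.
(* With [X'O] kept as first component, only the second one carries information. *)
suff [] : rels_imp2 (X'O, XO) (X'O, rmeet X'O X) by [].
apply: (lfp_le_prefixpoint rels_imp2_trans rels_imp2_anti rels_imp2_has_glb
  (progO_mono F_mono F'_mono) XO_lfp).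
split=> /=.
  (* [X_XO] bounds the argument of [F'] by [(X'O, XO)], where [F'] takes the value [X'O]. *)
  by have := F'_mono (X'O, rmeet X'O X) (X'O, XO); rewrite F'XO; apply; split=> // i t.
(* Reading the right-hand [X] as [F X] leaves only [rmeet X'O X] below [X] to check. *)
apply: rmeet_mono => [i t //|]; rewrite -{2}(proj1 X_lfp).
by apply: F_mono => i uv [].
Qed.
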